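(* Let $\mathbb{K}$ be a field of characteristic zero, let $\mathcal{W}(2)$ be the conservative algebra of $2$-dimensional algebras over $\mathbb{K}$, and let $d:\mathcal{W}(2)\to\mathcal{W}(2)$ be a linear map. Then $d$ is a $\frac12$-derivation of $\mathcal{W}(2)$ if and only if there exists a scalar $\lambda\in\mathbb{K}$ such that $d(x)=\lambda x$ for all $x\in\mathcal{W}(2)$.
   Context: Algebras are vector spaces over $\mathbb{K}$ with a bilinear multiplication; they need not be associative, commutative or unital. The algebra $\mathcal{W}(2)$ (Kantor's algebra of all bilinear multiplications on a $2$-dimensional space) is the $8$-dimensional algebra over $\mathbb{K}$ with basis $e_1,\dots,e_8$ and the following multiplication (left factor first; all products of basis elements not listed are $0$): $e_1e_1=-e_1$, $e_1e_4=e_4$, $e_1e_5=-2e_5$, $e_1e_6=-e_6$, $e_1e_7=-e_7$; $e_2e_1=-e_2-e_3$, $e_2e_2=-e_4$, $e_2e_3=-e_4$, $e_2e_5=e_1-e_6-e_7$, $e_2e_6=e_2-e_8$, $e_2e_7=e_3-e_8$, $e_2e_8=e_4$; $e_5e_1=e_5$, $e_5e_2=-e_1+e_6$, $e_5e_3=-e_1+e_7$, $e_5e_4=-e_2-e_3+e_8$, $e_5e_6=-e_5$, $e_5e_7=-e_5$, $e_5e_8=-e_6-e_7$; $e_6e_2=-e_2$, $e_6e_3=-e_3$, $e_6e_4=-2e_4$, $e_6e_5=e_5$, $e_6e_8=-e_8$. A linear map $d:\mathcal{A}\to\mathcal{A}$ on an algebra $\mathcal{A}$ is a $\frac12$-derivation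 if $d(xy)=\frac12\big(d(x)y+x\,d(y)\big)$ for all $x,y\in\mathcal{A}$. *)

(* Defs.v *)
From HB Require Import structures.
From mathcomp Require Import all_boot all_order all_algebra.

Set Implicit Arguments.
Unset Strict Implicit.
Unset Printing Implicit Defensive.

Import GRing.Theory.
Local Open Scope ring_scope.

Definition half_derivation (K : fieldType) (A : lmodType K)
    (mul : {bilinear A -> A -> A}) (d : {linear A -> A}) : Prop :=
  forall x y : A, d (mul x y) = 2^-1 *: (mul (d x) y + mul x (d y)).

Section KantorAlgebra.

Variable K : fieldType.

(* The underlying space of W(2) is K^8, as row vectors. The basis is numbered
   e_1, ..., e_8, whereas coordinates are indexed by 'I_8 = {0, ..., 7}: hence
   the shifts [k.-1] here and [i.+1] in [W2_mul]. *)
Definition W2_e (k : nat) : 'rV[K]_8 := delta_mx 0 (inord k.-1).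

Local Notation e := W2_e.

(* The product e_i e_j, with i the index of the left factor. *)
Definition W2_table (i j : nat) : 'rV[K]_8 :=
  match i, j with
  | 1%N, 1%N => - e 1
  | 1%N, 4%N => e 4
  | 1%N, 5%N => - (2 *: e 5)
  | 1%N, 6%N => - e 6
  | 1%N, 7%N => - e 7
  | 2%N, 1%N => - e 2 - e 3
  | 2%N, 2%N => - e 4
  | 2%N, 3%N => - e 4
  | 2%N, 5%N => e 1 - e 6 - e 7
  | 2%N, 6%N => e 2 - e 8
  | 2%N, 7%N => e 3 - e 8
  | 2%N, 8%N => e 4
  | 5%N, 1%N => e 5
  | 5%N, 2%N => - e 1 + e 6
  | 5%N, 3%N => - e 1 + e 7
  | 5%N, 4%N => - e 2 - e 3 + e 8
  | 5%N, 6%N => - e 5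
  | 5%N, 7%N => - e 5
  | 5%N, 8%N => - e 6 - e 7
  | 6%N, 2%N => - e 2
  | 6%N, 3%N => - e 3
  | 6%N, 4%N => - (2 *: e 4)
  | 6%N, 5%N => e 5
  | 6%N, 8%N => - e 8
  | _, _ => 0
  end.

Definition W2_mul (x y : 'rV[K]_8) : 'rV[K]_8 :=
  \sum_(i < 8) \sum_(j < 8) (x 0 i * y 0 j) *: W2_table i.+1 j.+1.

Lemma W2_mul_e (i j : nat) :
  (0 < i <= 8)%N -> (0 < j <= 8)%N -> W2_mul (e i) (e j) = W2_table i j.
Proof.
case: i j => [|i] [|j] //= lti ltj.
rewrite /W2_mul (bigD1 (inord i)) //= [X in _ + X]big1 => [|i' ne_i]; last first.
  by rewrite big1 // => j' _; rewrite /W2_e mxE (negPf ne_i) andbF mul0r scale0r.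
rewrite addr0 (bigD1 (inord j)) //= big1 => [|j' ne_j]; last first.
  by rewrite /W2_e !mxE (negPf ne_j) andbF mulr0 scale0r.
by rewrite /W2_e !mxE !eqxx mulr1 scale1r addr0 !inordK.
Qed.

Fact W2_mul_is_bilinear : bilinear_for *:%R *:%R W2_mul.
Proof.
split=> [y a x x' | x a y y']; rewrite /W2_mul /= scaler_sumr -big_split /=;
  apply: eq_bigr => i _; rewrite scaler_sumr -big_split /=;
  apply: eq_bigr => j _; rewrite !mxE scalerA -scalerDl.
  by rewrite mulrDl mulrA.
by rewrite mulrDr mulrCA.
Qed.

HB.instance Definition _ :=
  bilinear_isBilinear.Build K _ _ _ _ _ W2_mul W2_mul_is_bilinear.

End KantorAlgebra.

(* Main.v *)
Require Import Defs.
From mathcomp Require Import all_boot all_order all_algebra.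
From mathcomp Require Import ring.

Set Implicit Arguments.
Unset Strict Implicit.
Unset Printing Implicit Defensive.

Import GRing.Theory.
Local Open Scope ring_scope.

(** The algebra W(2) has a left unit, namely u = - (e_1 + e_6): the left
    multiplications by e_1 and by e_6 are both diagonal in the basis, and their
    eigenvalues on each e_j add up to -1 ([W2_left_unit]).  In an algebra with a
    left unit u, a half-derivation d satisfies 2 d(x) = 2 d(u x) = d(u) x + d(x),
    hence d(x) = d(u) x: it is enough to show that d(u) is a multiple of u
    ([half_derivation_left_unit]).

    For that, e_1 and e_6 are treated in turn.  Applying d to e_1 e_1 = - e_1
    gives 2 d(e_1) + d(e_1) e_1 + e_1 d(e_1) = 0, a triangular linear system
    which leaves only d(e_1) = lambda e_1 ([half_derivation_e1]).  Applying d to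
    e_1 e_6 = - e_6 then shows that d(e_6) - lambda e_6 is an eigenvector of the
    left multiplication by e_1 for the eigenvalue -2, that is, a multiple of
    e_5; and e_6 e_1 = 0 kills this multiple because e_5 e_1 = e_5
    ([half_derivation_e6]).  So d(u) = lambda u. *)

Section HalfDerivations.

Context {K : fieldType} {A : lmodType K} {mul : {bilinear A -> A -> A}}.
Context {d : {linear A -> A}}.
Hypotheses (two_neq0 : 2 != 0 :> K) (hd : half_derivation mul d).

Lemma half_derivationP x y : 2 *: d (mul x y) = mul (d x) y + mul x (d y).
Proof. by rewrite hd scalerA mulfV // scale1r. Qed.

(** From 2 d(x) = 2 d(u x) = d(u) x + u d(x) = lambda x + d(x). *)
Lemma half_derivation_left_unit u lambda :
  (forall x, mul u x = x) -> d u = lambda *: u -> forall x, d x = lambda *: x.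
Proof.
move=> mul_u du x; have := half_derivationP u x.
rewrite du linearZl_LR /= !mul_u scaler_nat mulr2n => /eqP.
by rewrite -subr_eq addrK => /eqP.
Qed.

End HalfDerivations.

Lemma scale_half_derivation {K : fieldType} {A : lmodType K}
    (mul : {bilinear A -> A -> A}) (d : {linear A -> A}) (lambda : K) :
  2 != 0 :> K -> (forall x, d x = lambda *: x) -> half_derivation mul d.
Proof.
move=> two_neq0 d_scale x y; rewrite !d_scale linearZl_LR linearZr_LR /=.
by rewrite -mulr2n -scaler_nat scalerA mulVf // scale1r.
Qed.

Section W2.

Variable K : fieldType.
Local Notation e := (W2_e K).
Implicit Types x : 'rV[K]_8.

Lemma W2_row_sum x : x = \sum_(j < 8) x 0 j *: e j.+1.
Proof.
by rewrite {1}[x]row_sum_delta; apply: eq_bigr => j _; rewrite /W2_e inord_val.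
Qed.

Lemma W2_mul_el k x : (0 < k <= 8)%N ->
  W2_mul (e k) x = \sum_(j < 8) x 0 j *: W2_table K k j.+1.
Proof.
move=> ltk; rewrite {1}(W2_row_sum x) linear_sumr; apply: eq_bigr => j _.
by rewrite linearZr_LR /= (@W2_mul_e K k j.+1 ltk (ltn_ord j)).
Qed.

Lemma W2_mul_er k x : (0 < k <= 8)%N ->
  W2_mul x (e k) = \sum_(i < 8) x 0 i *: W2_table K i.+1 k.
Proof.
move=> ltk; rewrite {1}(W2_row_sum x) linear_sumlz; apply: eq_bigr => i _.
by rewrite linearZl_LR /= (@W2_mul_e K i.+1 k (ltn_ord i) ltk).
Qed.

Lemma W2_mul_diag k (w : seq K) x : (0 < k <= 8)%N ->
    (forall j : 'I_8, W2_table K k j.+1 = w`_j *: e j.+1) ->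
  W2_mul (e k) x = \row_j (w`_j * x 0 j).
Proof.
move=> ltk diag_k; rewrite W2_mul_el // [RHS]W2_row_sum.
by apply: eq_bigr => j _; rewrite diag_k mxE scalerA mulrC.
Qed.

Lemma W2_mul_e1l x :
  W2_mul (e 1) x = \row_j ([:: -1; 0; 0; 1; -2; -1; -1; 0]`_j * x 0 j).
Proof.
apply: W2_mul_diag => // -[[|[|[|[|[|[|[|[|j]]]]]]]] ltj] //=;
  by rewrite ?scale0r ?scaleN1r ?scale1r ?scaleNr.
Qed.

Lemma W2_mul_e6l x :
  W2_mul (e 6) x = \row_j ([:: 0; -1; -1; -2; 1; 0; 0; -1]`_j * x 0 j).
Proof.
apply: W2_mul_diag => // -[[|[|[|[|[|[|[|[|j]]]]]]]] ltj] //=;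
  by rewrite ?scale0r ?scaleN1r ?scale1r ?scaleNr.
Qed.

Lemma W2_mul_e1r x :
  W2_mul x (e 1) = - (x 0 (inord 0) *: e 1) - x 0 (inord 1) *: (e 2 + e 3)
                   + x 0 (inord 4) *: e 5.
Proof.
rewrite W2_mul_er //.
under eq_bigr => i _ do rewrite -[in x 0 i](inord_val i).
rewrite !big_ord_recl big_ord0 /= !scaler0 !add0r !addr0.
by rewrite -opprD !scalerN addrA.
Qed.

(** The eigenvalues of e_1 and e_6 listed above add up to -1 in each position. *)
Lemma W2_left_unit x : W2_mul (- (e 1 + e 6)) x = x.
Proof.
rewrite linearNl linearDl /= W2_mul_e1l W2_mul_e6l.
apply/rowP => j; rewrite !mxE -mulrDl.
by case: j => -[|[|[|[|[|[|[|[|j]]]]]]]] ltj //=; ring.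
Qed.

Variable d : {linear 'rV[K]_8 -> 'rV[K]_8}.
Hypotheses (charK0 : [pchar K] =i pred0) (hd : half_derivation (@W2_mul K) d).

Lemma natS_neq0 n : n.+1%:R != 0 :> K.
Proof. by have /pcharf0P -> := charK0. Qed.

(** Solves one equation s = t of a linear system for the unknown a, when its
    coefficient is a positive integer, hence invertible in characteristic 0. *)
Lemma natS_mul_cancel n (a b s t : K) :
  s = t -> n.+1%:R * (a - b) = t - s -> a = b.
Proof.
move=> ->; rewrite subrr => /eqP.
by rewrite mulf_eq0 (negPf (natS_neq0 n)) subr_eq0 => /eqP.
Qed.

(** Since e_1 e_1 = - e_1, the vector a = d (e 1) satisfies a e_1 + e_1 a + 2 a = 0.
    The coordinate of a on e_2 has to be eliminated first, because e_2 e_1 is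
    not a multiple of e_2 but also has a component on e_3. *)
Lemma half_derivation_e1 : d (e 1) = d (e 1) 0 (inord 0) *: e 1.
Proof.
have := half_derivationP (natS_neq0 1) hd (e 1) (e 1).
rewrite /= W2_mul_e // linearN W2_mul_e1l W2_mul_e1r.
set a := d (e 1) => /rowP eq_a.
have a1 : a 0 (inord 1) = 0.
  have := eq_a (inord 1); rewrite !mxE -!val_eqE /= !inordK //= => eq1.
  by apply: (natS_mul_cancel (n := 0) eq1); ring.
apply/rowP => i; have := eq_a i; rewrite a1 !mxE -!val_eqE /= !inordK //=.
rewrite -[in a 0 i](inord_val i).
(* Let w_i be the eigenvalue of e_1 on e_(i+1).  Now that a_1 = 0, the coordinate
   of index i <> 0 of the equation reads (2 + w_i) a_i = 0, except that index 4
   has an extra term a_4 coming from e_5 e_1 = e_5, which makes up for w_4 = -2.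
   So the factor in front of a_i is always 1, 2 or 3. *)
case: i => -[|[|[|[|[|[|[|[|i]]]]]]]] lti //= eqi; rewrite ?mulr0 ?mulr1 //.
all: by first [ apply: (natS_mul_cancel (n := 0) eqi); ring
              | apply: (natS_mul_cancel (n := 1) eqi); ring
              | apply: (natS_mul_cancel (n := 2) eqi); ring ].
Qed.

(** The relation e_1 e_6 = - e_6 determines d (e 6) up to the eigenspace of the
    left multiplication by e_1 for the eigenvalue -2, twice that of e_6; this
    eigenspace is the line of e_5, on which e_6 e_1 = 0 decides. *)
Lemma half_derivation_e6 lambda :
  d (e 1) = lambda *: e 1 -> d (e 6) = lambda *: e 6.
Proof.
move=> d_e1.
have := half_derivationP (natS_neq0 1) hd (e 1) (e 6).
have := half_derivationP (natS_neq0 1) hd (e 6) (e 1).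
rewrite /= d_e1 linearZl_LR linearZr_LR /= !W2_mul_e //.
rewrite !(linearN, linear0, scaler0, addr0) W2_mul_e1l W2_mul_e1r.
set b := d (e 6) => /rowP/(_ (inord 4)) eq_b4 /rowP eq_b.
(* The product e_6 e_1 is 0, while b e_1 has coordinate b_4 on e_5. *)
have b4 : b 0 (inord 4) = 0.
  move: eq_b4; rewrite !mxE -!val_eqE /= !inordK //= => eq4.
  by apply: (natS_mul_cancel (n := 0) eq4); ring.
apply/rowP => i; have := eq_b i; rewrite !mxE -!val_eqE /= !inordK //=.
rewrite -[in b 0 i](inord_val i).
(* The coordinate of index i reads (2 + w_i) (b_i - lambda [i = 5]) = 0, with the
   same eigenvalues w_i; the factor vanishes only for i = 4, settled by b4. *)
case: i => -[|[|[|[|[|[|[|[|i]]]]]]]] lti //= eqi; rewrite ?b4 ?mulr0 //.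
all: by first [ apply: (natS_mul_cancel (n := 0) eqi); ring
              | apply: (natS_mul_cancel (n := 1) eqi); ring
              | apply: (natS_mul_cancel (n := 2) eqi); ring ].
Qed.

End W2.

Theorem theorem1p1 (K : fieldType) (charK0 : [pchar K] =i pred0)
    (d : {linear 'rV[K]_8 -> 'rV[K]_8}) :
  half_derivation (@W2_mul K) d <->
  exists lambda : K, forall x : 'rV[K]_8, d x = lambda *: x.
Proof.
have two_neq0 : 2 != 0 :> K := natS_neq0 charK0 1.
split=> [hd | [lambda d_scale]]; last exact: scale_half_derivation d_scale.
have d_e1 := half_derivation_e1 charK0 hd.
have d_e6 := half_derivation_e6 charK0 hd d_e1.
exists (d (W2_e K 1) 0 (inord 0)).
apply: (half_derivation_left_unit two_neq0 hd (@W2_left_unit K)).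
by rewrite linearN linearD /= {1}d_e1 d_e6 -scalerDr scalerN.
Qed.
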